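(* The algebra $\mathcal{T}$ is closed under the induced product.
   Context: $\mathscr{P}$ is the set of partitions and $r_m(\lambda)$ the number of parts of $\lambda$ equal to $m$. The Faulhaber polynomial $F_l$ is the polynomial with zero constant term with $F_l(n)=\sum_{i=1}^n i^{l-1}$ for $n\ge1$. For $k\ge0,l\ge1$, $k+l$ even, $T_{k,l}(\lambda)=-\frac{B_{k+l}}{2(k+l)}(\delta_{l,1}+\delta_{k,0})+\sum_{m\ge1}m^kF_l(r_m(\lambda))$. $\mathcal{T}$ is the $\mathbb{Q}$-algebra generated by the $T_{k,l}$ under the pointwise product. The induced product $f\odot g$ of $f,g:\mathscr{P}\to\mathbb{Q}$ is defined by $\langle f\odot g\rangle_{\vec u}=\langle f\rangle_{\vec u}\langle g\rangle_{\vec u}$, where $\langle f\rangle_{\vec u}=\sum_\lambda f(\lambda)u_{\lambda_1}u_{\lambda_2}\cdots/\sum_\lambda u_{\lambda_1}u_{\lambda_2}\cdots\in\mathbb{Q}[[u_1,u_2,\ldots]]$. *)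

(* Defs.v *)
From mathcomp Require Import all_boot all_order all_algebra.
Set Implicit Arguments. Unset Strict Implicit. Unset Printing Implicit Defensive.
Import Order.TTheory GRing.Theory Num.Theory.
Local Open Scope ring_scope.

Definition is_part (s : seq nat) : bool :=
  sorted geq s && all (fun x => (0 < x)%N) s.
Definition ipartition := {s : seq nat | is_part s}.
Definition part0 : ipartition := exist _ [::] erefl.
Definition topart (s : seq nat) : ipartition := insubd part0 s.

Definition mult (m : nat) (la : ipartition) : nat := count_mem m (val la).

(** Bernoulli numbers (B_0 = 1, sum_{j<=n} C(n+1,j) B_j = 0 for n >= 1). *)
Fixpoint bern_list (n : nat) : seq rat :=
  match n with
  | 0 => [:: 1]
  | n'.+1 => let s := bern_list n' in
      rcons s (- (n.+1%:R)^-1 * \sum_(j < n) ('C(n.+1, j))%:R * s`_j)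
  end.
Definition bernoulli (n : nat) : rat := (bern_list n)`_n.

(** Faulhaber polynomial F_l evaluated at a natural number n
    (F_l(n) = sum_{i=1}^n i^(l-1), and F_l(0) = 0 since zero constant term). *)
Definition faulhaber (l n : nat) : rat := \sum_(1 <= i < n.+1) (i%:R) ^+ l.-1.

(** T_{k,l}; the sum over m >= 1 is finite since F_l(0) = 0 and r_m = 0 for
    m larger than |lambda|. *)
Definition Tkl (k l : nat) (la : ipartition) : rat :=
  - bernoulli (k + l) / (2 * (k + l)%:R) * ((l == 1)%:R + (k == 0)%:R)
  + \sum_(1 <= m < (sumn (val la)).+1) (m%:R) ^+ k * faulhaber l (mult m la).

Inductive inT : (ipartition -> rat) -> Prop :=
  | inT_gen k l : (0 < l)%N -> ~~ odd (k + l) -> inT (Tkl k l)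
  | inT_const (c : rat) : inT (fun _ => c)
  | inT_add f g : inT f -> inT g -> inT (fun la => f la + g la)
  | inT_mul f g : inT f -> inT g -> inT (fun la => f la * g la).

(** Formal power series in Q[[u_1,u_2,...]]: the monomial u_{la_1} u_{la_2} ...
    is indexed by the ipartition la, so a series is a function ipartition -> rat
    (its coefficient family). *)
Definition series := ipartition -> rat.

Fixpoint bitseqs (n : nat) : seq bitseq :=
  match n with
  | 0 => [:: [::]]
  | n'.+1 => [seq b :: s | b <- [:: true; false], s <- bitseqs n']
  end.

(** all ways of writing the monomial la as a product of two monomials mu * nu *)
Definition decomp (s : seq nat) : seq (seq nat * seq nat) :=
  undup [seq (mask m s, mask (map negb m) s) | m <- bitseqs (size s)].

Definition mulS (A B : series) : series := fun la =>
  \sum_(p <- decomp (val la)) A (topart p.1) * B (topart p.2).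

Fixpoint inv_rec (n : nat) (A : series) (la : ipartition) : rat :=
  if val la == [::] then (A part0)^-1 else
  match n with
  | 0 => 0
  | n'.+1 => - (A part0)^-1 *
      \sum_(p <- decomp (val la) | p.1 != val la)
         inv_rec n' A (topart p.1) * A (topart p.2)
  end.
Definition invS (A : series) : series := fun la => inv_rec (size (val la)) A la.

Definition genser (f : ipartition -> rat) : series := f.

Definition qbracket (f : ipartition -> rat) : series :=
  mulS (genser f) (invS (genser (fun _ => 1))).

(* Main.v *)
(** Induced multiplication by the power moment
    S_{k,l} = sum_m m^k F_l(r_m) is the operator that removes s >= 1 copies of a
    part m with weight m^k s^(l-1), while pointwise multiplication by S_{k,l}
    keeps the partition. Both are kernel operators
    f |-> sum_m m^k sum_s K(r_m, s) f(la - m^s), and the commutator of two of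
    these is again one. Kernels spanned by (2r+1)^a s^b with b >= 1 and a + b
    of fixed parity are stable under commutators with the removal operators,
    because sum_(j < t) (2j+1)^i is a combination of the t^c with c >= 1 and
    c = i + 1 mod 2. Hence, on induced products of at most n power moments,
    pointwise and induced multiplication by S_{k,l} differ by induced products
    of at most n power moments, so T is also generated by the power moments
    under the induced product. *)
Require Import Defs.
From mathcomp Require Import all_boot all_order all_algebra.
From mathcomp Require Import ring lra zify.
Set Implicit Arguments.
Unset Strict Implicit.
Unset Printing Implicit Defensive.
Import Order.TTheory GRing.Theory Num.Theory.
Local Open Scope ring_scope.

(** * Power sums and parity *)

(** [lspan_ext] identifies functions that agree on [D], which avoids functional extensionality and
    leaves values off [D] free. *)
Inductive lspan (X : Type) (D : pred X) (G : (X -> rat) -> Prop) :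
    (X -> rat) -> Prop :=
  | lspan_gen f : G f -> lspan D G f
  | lspanD f g : lspan D G f -> lspan D G g -> lspan D G (fun x => f x + g x)
  | lspanZ c f : lspan D G f -> lspan D G (fun x => c * f x)
  | lspan0 : lspan D G (fun _ => 0)
  | lspan_ext f g : (forall x, D x -> f x = g x) -> lspan D G f -> lspan D G g.

Lemma lspan_sum (X : Type) (D : pred X) G (I : Type) (r : seq I) (P : pred I)
    (F : I -> X -> rat) :
  (forall i, P i -> lspan D G (F i)) ->
  lspan D G (fun x => \sum_(i <- r | P i) F i x).
Proof.
move=> GF; elim: r => [|i r IHr].
  by apply: lspan_ext (lspan0 D G) => x _; rewrite big_nil.
have [Pi|nPi] := boolP (P i).
  apply: lspan_ext (lspanD (GF i Pi) IHr) => x _.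
  by rewrite big_cons Pi.
by apply: lspan_ext IHr => x _; rewrite big_cons (negPf nPi).
Qed.

(** Through this lemma, parity claims about a linear map [phi] reduce to monomial generators. *)
Lemma lspan_map (X Y : Type) (D : pred X) G (D' : pred Y) G'
    (phi : (X -> rat) -> Y -> rat) :
  (forall f g, (forall x, D x -> f x = g x) ->
     forall y, D' y -> phi f y = phi g y) ->
  (forall f g y, D' y -> phi (fun x => f x + g x) y = phi f y + phi g y) ->
  (forall c f y, D' y -> phi (fun x => c * f x) y = c * phi f y) ->
  (forall f, G f -> lspan D' G' (phi f)) ->
  forall f, lspan D G f -> lspan D' G' (phi f).
Proof.
move=> phi_ext phiD phiZ phiG f.
elim=> {f} [f Gf|f g _ IHf _ IHg|c f _ IHf||f g efg _ IHf].
- exact: phiG.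
- by apply: lspan_ext (lspanD IHf IHg) => y Dy; rewrite phiD.
- by apply: lspan_ext (lspanZ c IHf) => y Dy; rewrite phiZ.
- apply: lspan_ext (lspan0 D' G') => y Dy.
  rewrite (phi_ext _ (fun x => 0 * (fun _ => 0) x) _ y Dy) ?phiZ ?mul0r //.
- by apply: (lspan_ext _ IHf) => y Dy; apply: phi_ext Dy.
Qed.

Definition pow_span (e : bool) : (nat -> rat) -> Prop :=
  lspan predT (fun f => exists c, [/\ (0 < c)%N, odd c = e
                                    & f = fun t => t%:R ^+ c]).

Lemma pow_spanX (c : nat) : (0 < c)%N -> pow_span (odd c) (fun t => t%:R ^+ c).
Proof. by move=> c_gt0; apply: lspan_gen; exists c. Qed.

Lemma pow_spanMX (d : nat) e f :
  pow_span e f -> pow_span (odd d (+) e) (fun t => t%:R ^+ d * f t).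
Proof.
move: f; apply: lspan_map => [f g efg t _|f g t _|c f t _|_ [c [c_gt0 <- ->]]].
- by rewrite efg.
- by rewrite mulrDr.
- by rewrite mulrCA.
- have dc_gt0 : (0 < d + c)%N by rewrite addn_gt0 c_gt0 orbT.
  rewrite -oddD; apply: lspan_ext (pow_spanX dc_gt0) => t _.
  by rewrite exprD.
Qed.

Definition odd_power_sum (i t : nat) : rat := \sum_(j < t) (j.*2.+1)%:R ^+ i.

(* Telescoping [(2j+2)^i.+1 - (2j)^i.+1], expanded around [2j+1]. *)
Lemma odd_power_sum_span i : pow_span (~~ odd i) (odd_power_sum i).
Proof.
elim/ltn_ind: i => i IHi.
(* The coefficient of x^q in (x+1)^(i+1) - (x-1)^(i+1); it vanishes unless q and i have the same
   parity. *)
pose w q : rat := (1 - (-1) ^+ (i.+1 - q)) *+ 'C(i.+1, q).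
have tele t : (2 * t%:R) ^+ i.+1 = \sum_(q < i.+2) w q * odd_power_sum q t.
  elim: t => [|t IHt].
    rewrite mulr0 expr0n big1 // => q _.
    by rewrite /odd_power_sum big_ord0 mulr0.
  have -> : (2 * t.+1%:R : rat) = 1 + (t.*2.+1)%:R by rewrite -muln2; lra.
  transitivity ((2 * t%:R) ^+ i.+1 + \sum_(q < i.+2) w q * (t.*2.+1)%:R ^+ q).
    have -> : (2 * t%:R : rat) = -1 + (t.*2.+1)%:R by rewrite -muln2; lra.
    rewrite !exprDn -big_split; apply: eq_bigr => q _ /=.
    by rewrite expr1n /w mul1r; ring.
  rewrite IHt -big_split; apply: eq_bigr => q _ /=.
  by rewrite /odd_power_sum big_ord_recr /= mulrDr.
have Hodd : pow_span (~~ odd i) (fun t => (2 * t%:R) ^+ i.+1).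
  apply: lspan_ext (lspanZ (2 ^+ i.+1) (@pow_spanX i.+1 isT)) => t _.
  by rewrite exprMn.
have Hlow : pow_span (~~ odd i) (fun t => \sum_(q < i) w q * odd_power_sum q t).
  apply: lspan_sum => q _.
  have [eq_qi|] := boolP (odd q == odd i).
    by apply: lspanZ; rewrite -(eqP eq_qi); apply: IHi.
  move=> ne_qi; apply: lspan_ext (lspan0 _ _) => t _.
  rewrite /w -signr_odd oddB; last by rewrite ltnW // ltnS ltnW.
  rewrite (_ : odd i.+1 (+) odd q = false) ?subrr ?mul0rn ?mul0r //=.
  by case: (odd i) (odd q) ne_qi => [] [].
have wi : w i = 2 * i.+1%:R.
  by rewrite /w subSnn expr1 opprK binSn -mulr_natr.
have w_last : w i.+1 = 0 by rewrite /w subnn expr0 subrr mul0rn.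
(* The telescoped identity is solved for its term q = i, whose coefficient 2(i+1) is nonzero; the
   terms q < i are covered by induction. *)
apply: lspan_ext (lspanZ (2 * i.+1%:R)^-1 (lspanD Hodd (lspanZ (-1) Hlow))) => t _ /=.
rewrite tele !big_ord_recr /= w_last wi mul0r addr0 mulN1r addrAC subrr add0r.
by rewrite mulKf // mulf_neq0 // pnatr_eq0.
Qed.

(** For n > 0 the half weight at the endpoint cancels the term -t^n/2 of the power sum, the only one
    whose exponent has the parity of n. *)
Definition trapezoid (n t : nat) : rat := \sum_(s < t) s%:R ^+ n + t%:R ^+ n / 2.

(** With x = 2t+1, the increment of 2^(n+1) [trapezoid n] at t is (x+1)^n + (x-1)^n. It contains
    only powers x^q with q of the parity of n, and [odd_power_sum_span] sums these. *)
Lemma trapezoid_span n : (0 < n)%N -> pow_span (~~ odd n) (trapezoid n).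
Proof.
move=> n_gt0.
pose w q : rat := (1 + (-1) ^+ (n - q)) *+ 'C(n, q).
have expand t : 2 ^+ n.+1 * trapezoid n t = \sum_(q < n.+1) w q * odd_power_sum q t.
  elim: t => [|t IHt].
    rewrite /trapezoid big_ord0 expr0n -[n == 0%N]negbK -lt0n n_gt0 mul0r addr0.
    by rewrite mulr0 big1 // => q _; rewrite /odd_power_sum big_ord0 mulr0.
  transitivity (2 ^+ n.+1 * trapezoid n t + \sum_(q < n.+1) w q * (t.*2.+1)%:R ^+ q).
    have -> : \sum_(q < n.+1) w q * (t.*2.+1)%:R ^+ q
       = (1 + (t.*2.+1)%:R) ^+ n + (-1 + (t.*2.+1)%:R) ^+ n.
      rewrite !exprDn -big_split; apply: eq_bigr => q _ /=.
      by rewrite expr1n /w mul1r; ring.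
    have -> : (1 + (t.*2.+1)%:R : rat) = 2 * t.+1%:R by rewrite -muln2; lra.
    have -> : (-1 + (t.*2.+1)%:R : rat) = 2 * t%:R by rewrite -muln2; lra.
    by rewrite /trapezoid big_ord_recr /= !exprMn exprS; field.
  rewrite IHt -big_split; apply: eq_bigr => q _ /=.
  by rewrite /odd_power_sum big_ord_recr /= mulrDr.
have Hsum : pow_span (~~ odd n) (fun t => \sum_(q < n.+1) w q * odd_power_sum q t).
  apply: lspan_sum => q _.
  have [eq_qn|ne_qn] := boolP (odd q == odd n).
    by apply: lspanZ; rewrite -(eqP eq_qn); apply: odd_power_sum_span.
  apply: lspan_ext (lspan0 _ _) => t _.
  rewrite /w -signr_odd oddB -1?ltnS //.
  rewrite (_ : odd n (+) odd q = true) ?subrr ?mul0rn ?mul0r //=.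
  by case: (odd n) (odd q) ne_qn => [] [].
apply: lspan_ext (lspanZ (2 ^+ n.+1)^-1 Hsum) => t _.
by rewrite -expand mulKf // expf_neq0.
Qed.

(* The half-endpoint corrections of the trapezoidal sums cancel because
   [\sum_j (-1)^j 'C(b, j) = 0]. *)
Lemma power_convolution_span a b : (0 < a)%N -> (0 < b)%N ->
  pow_span (~~ odd (a + b)) (fun t => \sum_(s < t.+1) s%:R ^+ a * (t - s)%:R ^+ b).
Proof.
move=> a_gt0 b_gt0.
pose w j : rat := (-1) ^+ j *+ 'C(b, j).
have expand t : \sum_(s < t.+1) s%:R ^+ a * (t - s)%:R ^+ b
    = \sum_(j < b.+1) w j * (t%:R ^+ (b - j) * trapezoid (a + j) t).
  have end_cancel : \sum_(j < b.+1) w j * (t%:R ^+ (b - j) * t%:R ^+ (a + j)) = 0.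
    transitivity (t%:R ^+ a * (t%:R - t%:R) ^+ b : rat).
      rewrite exprBn mulr_sumr; apply: eq_bigr => j _.
      by rewrite exprD /w; ring.
    by rewrite subrr expr0n -[b == 0%N]negbK -lt0n b_gt0 mulr0.
  transitivity (\sum_(j < b.+1) w j * (t%:R ^+ (b - j)
                 * \sum_(s < t.+1) s%:R ^+ (a + j))).
    under [RHS]eq_bigr do rewrite !mulr_sumr.
    rewrite exchange_big /=; apply: eq_bigr => s _.
    rewrite natrB -1?ltnS // exprBn mulr_sumr; apply: eq_bigr => j _.
    by rewrite exprD /w; ring.
  (* Adding -1/2 times the vanishing sum [end_cancel] turns full power sums into trapezoidal
     ones. *)
  rewrite -[LHS]addr0 -[X in _ + X = _](mul0r (- (1 / 2))) -[X in _ + X * _]end_cancel.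
  rewrite mulr_suml.
  rewrite -big_split; apply: eq_bigr => j _ /=.
  by rewrite /trapezoid big_ord_recr /=; field.
apply: lspan_ext (fun t _ => esym (expand t)) _.
apply: lspan_sum => j _; apply: lspanZ.
have j_le : (j <= b)%N by rewrite -ltnS.
have -> : ~~ odd (a + b) = odd (b - j) (+) ~~ odd (a + j).
  by rewrite oddB // !oddD; case: (odd a) (odd b) (odd j) => [] [] [].
by apply: pow_spanMX; apply: trapezoid_span; rewrite addn_gt0 a_gt0.
Qed.

(** Here [e] is the parity of the summed power, not of the Faulhaber index, which is one larger. *)
Definition faulhaber_span (e : bool) : (nat -> rat) -> Prop :=
  lspan predT (fun f => exists c, [/\ (0 < c)%N, odd c = e & f = faulhaber c.+1]).

Lemma faulhaber_span_sum e f :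
  pow_span e f -> faulhaber_span e (fun r => \sum_(1 <= i < r.+1) f i).
Proof.
move: f; apply: lspan_map => [f g efg r _|f g r _|c f r _|_ [c [c_gt0 ec ->]]].
- by apply: eq_bigr => i _; rewrite efg.
- by rewrite big_split.
- by rewrite mulr_sumr.
- by apply: lspan_gen; exists c.
Qed.

(** Summation by parts: for F = [faulhaber c.+1], the increment (2r+1)F(r) - (2r-1)F(r-1) equals
    2r^(c+1) + 2 [trapezoid c r], and both terms have the parity opposite to c. *)
Lemma faulhaber_spanM e f :
  faulhaber_span e f -> faulhaber_span (~~ e) (fun r => (r.*2.+1)%:R * f r).
Proof.
move: f; apply: lspan_map => [f g efg|f g|c f|_ [c [c_gt0 <- ->]]].
- by move=> r _; rewrite efg.
- by move=> r _; rewrite mulrDr.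
- by move=> r _; rewrite mulrCA.
have: pow_span (~~ odd c) (fun i => 2 * i%:R ^+ c.+1 + 2 * trapezoid c i).
  apply: lspanD; apply: lspanZ; [exact: (@pow_spanX c.+1) | exact: trapezoid_span].
move/faulhaber_span_sum; apply: lspan_ext => r _.
have sum0 n : \sum_(1 <= i < n.+1) i%:R ^+ c = \sum_(i < n.+1) i%:R ^+ c :> rat.
  rewrite big_add1 /= big_mkord [RHS]big_ord_recl expr0n.
  by rewrite -[c == 0%N]negbK -lt0n c_gt0 add0r.
elim: r => [|r IHr]; first by rewrite /faulhaber !big_geq // mulr0.
rewrite big_nat_recr //= IHr /faulhaber !sum0 /trapezoid [in RHS]big_ord_recr /=.
set S := \sum_(i < _) _.
by rewrite exprS -!muln2 -!natr1 !natrM -!natr1; field.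
Qed.

Lemma faulhaber_spanMX a e f :
  faulhaber_span e f ->
  faulhaber_span (odd a (+) e) (fun r => (r.*2.+1)%:R ^+ a * f r).
Proof.
move=> Gf; elim: a => [|a IHa].
  by apply: lspan_ext Gf => r _; rewrite mul1r.
move/faulhaber_spanM: IHa; rewrite -addNb /=; apply: lspan_ext => r _.
by rewrite exprS mulrA.
Qed.

(** * Kernels *)

(* A kernel at [(r, s)] is the weight of removing [s] of [r] copies, so it only
   matters for [s <= r]; there no natural subtraction below is truncated. *)
Definition in_triangle (x : nat * nat) : bool := (x.2 <= x.1)%N.

Definition kernel_span (e : bool) : (nat * nat -> rat) -> Prop :=
  lspan in_triangle (fun K => exists a b,
    [/\ (0 < b)%N, odd (a + b) = e
      & K = fun x => (x.1.*2.+1)%:R ^+ a * x.2%:R ^+ b]).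

Lemma kernel_spanM a e f :
  pow_span e f ->
  kernel_span (odd a (+) e) (fun x => (x.1.*2.+1)%:R ^+ a * f x.2).
Proof.
move: f; apply: lspan_map => [f g efg|f g|c f|_ [c [c_gt0 <- ->]]].
- by move=> x _; rewrite efg.
- by move=> x _; rewrite mulrDr.
- by move=> x _; rewrite mulrCA.
- by apply: lspan_gen; exists a, c; rewrite oddD.
Qed.

(** The factor [(0 < x.2)%:R] excludes the empty removal when [l.-1] is 0, where [0 ^+ 0] is 1. *)
Definition add_kernel (l : nat) (x : nat * nat) : rat :=
  (0 < x.2)%:R * x.2%:R ^+ l.-1.

Definition mul_kernel (l : nat) (x : nat * nat) : rat :=
  (x.2 == 0)%:R * faulhaber l x.1.

(** In both products [K] removes s copies and [K'] removes t - s; they differ in which removal sees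
    the original multiplicity. *)
Definition comm_kernel (K K' : nat * nat -> rat) (x : nat * nat) : rat :=
  \sum_(s < x.2.+1) (K (x.1, val s) * K' (x.1 - s, x.2 - s)%N
                     - K' (x.1, x.2 - s)%N * K (x.1 - (x.2 - s), val s)%N).

(** Since [mul_kernel] lives on s = 0, the commutator at (r, t) is t^(l'-1) (F_l(r) - F_l(r-t)). The
    difference is the sum of (r-j)^(l-1) over j < t, and writing r - j = ((2r+1) - (2j+1))/2 turns
    its binomial expansion into odd power sums. *)
Lemma comm_mul_add_kernel l l' : (0 < l)%N -> (0 < l')%N ->
  kernel_span (~~ odd (l + l')) (comm_kernel (mul_kernel l) (add_kernel l')).
Proof.
move=> l_gt0 l'_gt0.
pose w i : rat := (2 ^+ l.-1)^-1 * ((-1) ^+ i *+ 'C(l.-1, i)).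
have expand r t : (t <= r)%N ->
    \sum_(i < l) w i * ((r.*2.+1)%:R ^+ (l.-1 - i) * odd_power_sum i t)
    = faulhaber l r - faulhaber l (r - t).
  elim: t => [_|t IHt lt_tr].
    rewrite subn0 subrr big1 // => i _.
    by rewrite /odd_power_sum big_ord0 !mulr0.
  have -> : faulhaber l (r - t.+1) = faulhaber l (r - t) - (r - t)%:R ^+ l.-1.
    rewrite (_ : r - t = (r - t.+1).+1)%N; last lia.
    by rewrite [in RHS]/faulhaber big_nat_recr //= addrK.
  rewrite opprB addrA addrAC -IHt; last exact: ltnW.
  have -> : (r - t)%:R = ((r.*2.+1)%:R - (t.*2.+1)%:R) / 2 :> rat.
    by rewrite natrB 1?ltnW // -!muln2 -!natr1 !natrM; field.
  rewrite expr_div_n exprBn prednK // mulr_suml -big_split.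
  apply: eq_bigr => i _ /=.
  rewrite /odd_power_sum big_ord_recr /= /w; ring.
have base : kernel_span (~~ odd (l + l')) (fun x => \sum_(i < l)
    w i * ((x.1.*2.+1)%:R ^+ (l.-1 - i) * (x.2%:R ^+ l'.-1 * odd_power_sum i x.2))).
  apply: lspan_sum => i _; apply: lspanZ.
  have -> : ~~ odd (l + l') = odd (l.-1 - i) (+) (odd l'.-1 (+) ~~ odd i).
    clear w expand; case: l l_gt0 i => // l _ i; case: l' l'_gt0 => // l' _ /=.
    rewrite oddB -1?ltnS //= !oddD /=.
    by case: (odd l) (odd l') (odd i) => [] [] [].
  exact: (kernel_spanM _ (pow_spanMX l'.-1 (odd_power_sum_span i))).
apply: lspan_ext base => [[r t] le_tr /=].
rewrite /comm_kernel [RHS]big_ord_recl [X in _ + X]big1 /=; last first.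
  by move=> i _; rewrite /mul_kernel /= !mul0r mulr0 subrr.
rewrite /mul_kernel /add_kernel /= !subn0 !mul1r addr0.
transitivity (t%:R ^+ l'.-1 * (faulhaber l r - faulhaber l (r - t))).
  rewrite -expand // mulr_sumr; apply: eq_bigr => i _; ring.
case: t le_tr => [|t] _; last by rewrite mul1r; ring.
by rewrite subn0 subrr !(mulr0, mul0r) subrr.
Qed.

(** [add_kernel] ignores the multiplicity, so a monomial kernel contributes s^b u^(l-1) ((2r+1)^a -
    (2(r-u)+1)^a) with u = t - s. The term free of u cancels in the bracket; what remains are
    convolutions of positive powers of s and u. *)
Lemma comm_kernel_span e K l : (0 < l)%N ->
  kernel_span e K -> kernel_span (odd l (+) e) (comm_kernel K (add_kernel l)).
Proof.
move=> l_gt0; move: K; apply: lspan_map.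
- move=> f g efg [r t] le_tr; apply: eq_bigr => s _ /=.
  have := ltn_ord s; rewrite /in_triangle /= in le_tr * => lt_st.
  by rewrite !efg // /in_triangle /=; lia.
- by move=> f g x _; rewrite -big_split; apply: eq_bigr => s _ /=; ring.
- by move=> c f x _; rewrite mulr_sumr; apply: eq_bigr => s _ /=; ring.
move=> _ [a [b [b_gt0 <- ->]]].
pose w i : rat := - ((- 2) ^+ i *+ 'C(a, i)).
pose C i (t : nat) : rat := \sum_(s < t.+1) s%:R ^+ b * (t - s)%:R ^+ i.
have base : kernel_span (odd l (+) odd (a + b)) (fun x => \sum_(i < a)
    w i.+1 * ((x.1.*2.+1)%:R ^+ (a - i.+1) * C (i + l)%N x.2)).
  apply: lspan_sum => i _; apply: lspanZ.
  have -> : odd l (+) odd (a + b) = odd (a - i.+1) (+) ~~ odd (b + (i + l)).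
    rewrite oddB // !oddD /=.
    by case: (odd a) (odd b) (odd l) (odd i) => [] [] [] [].
  apply: kernel_spanM; apply: power_convolution_span => //.
  by rewrite addn_gt0 l_gt0 orbT.
apply: lspan_ext base => [[r t]]; rewrite /in_triangle /= => le_tr.
under eq_bigr do rewrite !mulr_sumr.
rewrite exchange_big /=; apply: eq_bigr => s _ /=.
have le_st : (s <= t)%N by rewrite -ltnS.
rewrite /add_kernel /=; set u := (t - s)%N.
have -> : ((r - u).*2.+1)%:R = (r.*2.+1)%:R + (- 2) * u%:R :> rat.
  rewrite -!natr1 -!muln2 !natrM natrB; last by rewrite /u; lia.
  by ring.
rewrite exprDn big_ord_recl subn0 bin0 expr0 mulr1 /=.
set S : rat := (X in _ = _ - _ * ((_ + X) * _)).
transitivity (- ((0 < u)%:R * u%:R ^+ l.-1 * s%:R ^+ b * S)); last by rewrite mulr1n; ring.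
rewrite mulr_sumr -sumrN; apply: eq_bigr => i _.
rewrite /bump leq0n add1n exprMn /w.
(* The indicator can be absorbed because i + l > 0 makes both sides vanish at u = 0. *)
have -> : u%:R ^+ (i + l) = (0 < u)%:R * u%:R ^+ l.-1 * u%:R ^+ i.+1 :> rat.
  rewrite -mulrA -exprD (_ : l.-1 + i.+1 = i + l)%N; last lia.
  clear S; case: u => [|u]; last by rewrite mul1r.
  by rewrite mul0r expr0n (_ : (i + l == 0)%N = false) //; lia.
ring.
Qed.

(** Serves to evaluate kernel operators on constants. A monomial kernel has row sum (2r+1)^a
    F_(b+1)(r), which [faulhaber_spanMX] keeps in the span. *)
Lemma kernel_row_sum e K :
  kernel_span e K ->
  faulhaber_span e (fun r => \sum_(s < r.+1) K (r, val s)).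
Proof.
move: K; apply: lspan_map => [f g efg r _|f g r _|c f r _|_ [a [b [b_gt0 <- ->]]]].
- apply: eq_bigr => s _; apply: efg.
  by rewrite /in_triangle /= -ltnS.
- by rewrite big_split.
- by rewrite mulr_sumr.
have: faulhaber_span (odd b) (faulhaber b.+1) by apply: lspan_gen; exists b.
move/(faulhaber_spanMX a); rewrite -oddD; apply: lspan_ext => r _ /=.
rewrite -mulr_sumr /faulhaber big_add1 /= big_mkord [in RHS]big_ord_recl.
by rewrite expr0n -[b == 0%N]negbK -lt0n b_gt0 add0r.
Qed.

(** * Kernel operators on functions of partitions *)

Definition remove_parts (la : ipartition) (t : seq nat) : ipartition :=
  topart (foldl (fun s x => rem x s) (val la) t).

Lemma is_part_subseq s t : subseq s t -> is_part t -> is_part s.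
Proof.
move=> sub_st /andP[t_sorted t_gt0]; apply/andP; split.
  by apply: subseq_sorted t_sorted => // x y z /= lexy lezx; apply: leq_trans lezx lexy.
by apply/allP => x /(mem_subseq sub_st) /(allP t_gt0).
Qed.

Lemma topartK s : is_part s -> val (topart s) = s.
Proof. exact: insubdK. Qed.

Lemma part_eq_seq s t : is_part s -> is_part t ->
  (forall m, count_mem m s = count_mem m t) -> s = t.
Proof.
move=> /andP[s_sorted _] /andP[t_sorted _] eq_st.
apply: (sorted_eq (leT := geq)) => //.
- by move=> x y z /= lexy lezx; apply: leq_trans lezx lexy.
- by move=> x y /andP[/= leyx lexy]; apply/eqP; rewrite eqn_leq lexy.
- by apply/allP => m _; rewrite /= eq_st.
Qed.

Lemma part_eq (x y : ipartition) : (forall m, mult m x = mult m y) -> x = y.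
Proof. by move=> eq_xy; apply/val_inj/part_eq_seq => //; apply: valP. Qed.

Lemma foldl_rem_subseq (s t : seq nat) :
  subseq (foldl (fun s x => rem x s) s t) s.
Proof.
elim: t s => //= x t IHt s.
exact: subseq_trans (IHt _) (rem_subseq _ _).
Qed.

Lemma val_remove_parts la t :
  val (remove_parts la t) = foldl (fun s x => rem x s) (val la) t.
Proof. exact: topartK (is_part_subseq (foldl_rem_subseq _ _) (valP la)). Qed.

Lemma mult_remove_parts m la t :
  mult m (remove_parts la t) = (mult m la - count_mem m t)%N.
Proof.
rewrite /mult val_remove_parts; elim: t (val la) => [|x t IHt] s /=.
  by rewrite subn0.
by rewrite IHt count_mem_rem subnDA.
Qed.

Lemma remove_partsC la t t' :
  remove_parts (remove_parts la t) t' = remove_parts (remove_parts la t') t.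
Proof. by apply: part_eq => m; rewrite !mult_remove_parts subnAC. Qed.

Lemma sumn_subseq s t : subseq s t -> (sumn s <= sumn t)%N.
Proof.
elim: t s => [|y t IHt] [|x s] //=.
by case: eqP => [-> /IHt|_ /IHt /=]; lia.
Qed.

Lemma sumn_remove_parts la t :
  (sumn (val (remove_parts la t)) <= sumn (val la))%N.
Proof. by rewrite val_remove_parts sumn_subseq ?foldl_rem_subseq. Qed.

Lemma mult_large m la : (sumn (val la) < m)%N -> mult m la = 0%N.
Proof.
move=> lt_la_m; apply/count_memPn/negP => m_la.
rewrite -sub1seq in m_la.
by move/sumn_subseq: m_la; rewrite [sumn [:: m]]addn0 leqNgt lt_la_m.
Qed.

Definition kernel_op (k : nat) (K : nat * nat -> rat) (f : ipartition -> rat)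
    (la : ipartition) : rat :=
  \sum_(1 <= m < (sumn (val la)).+1) m%:R ^+ k
    * \sum_(s < (mult m la).+1) K (mult m la, val s) * f (remove_parts la (nseq s m)).

Lemma remove_parts0 la : remove_parts la [::] = la.
Proof. exact: valKd. Qed.

(** A part larger than the size of [la] has multiplicity 0 and contributes only [K (0, 0)]. Thus
    smaller partitions can share the summation bound of a larger one. *)
Lemma kernel_op_widen N k K f la : K (0, 0)%N = 0 -> (sumn (val la) <= N)%N ->
  kernel_op k K f la = \sum_(1 <= m < N.+1) m%:R ^+ k
    * \sum_(s < (mult m la).+1) K (mult m la, val s) * f (remove_parts la (nseq s m)).
Proof.
move=> K0 le_N; rewrite [RHS](@big_cat_nat _ _ _ (sumn (val la)).+1) //=.
rewrite [X in _ + X]big_nat_cond [X in _ + X]big1 ?addr0 // => m.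
case/andP=> [/andP[lt_m _] _].
by rewrite mult_large // big_ord1 /= K0 mul0r mulr0.
Qed.

Lemma kernel_op_ext k K f g la :
  (forall mu, f mu = g mu) -> kernel_op k K f la = kernel_op k K g la.
Proof.
by move=> efg; apply: eq_bigr => m _; congr (_ * _); apply: eq_bigr => s _; rewrite efg.
Qed.

Lemma kernel_op_ext_kernel k K K' f la :
  (forall x, in_triangle x -> K x = K' x) -> kernel_op k K f la = kernel_op k K' f la.
Proof.
move=> eK; apply: eq_bigr => m _; congr (_ * _); apply: eq_bigr => s _.
by rewrite eK // /in_triangle /= -ltnS.
Qed.

Lemma kernel_opD k K f g la :
  kernel_op k K (fun mu => f mu + g mu) la = kernel_op k K f la + kernel_op k K g la.
Proof.
rewrite -big_split; apply: eq_bigr => m _ /=; rewrite -mulrDr -big_split.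
by congr (_ * _); apply: eq_bigr => s _ /=; rewrite mulrDr.
Qed.

Lemma kernel_opZ k K c f la :
  kernel_op k K (fun mu => c * f mu) la = c * kernel_op k K f la.
Proof.
rewrite mulr_sumr; apply: eq_bigr => m _; rewrite mulrCA; congr (_ * _).
by rewrite mulr_sumr; apply: eq_bigr => s _; rewrite mulrCA.
Qed.

Lemma triangle_sum_reindex r (G : nat -> nat -> rat) :
  \sum_(s < r.+1) \sum_(u < (r - s).+1) G s u
  = \sum_(t < r.+1) \sum_(s < t.+1) G s (t - s)%N.
Proof.
elim: r => [|r IHr]; first by rewrite !big_ord1.
rewrite big_ord_recr /= subnn big_ord1 [RHS]big_ord_recr /= -IHr.
rewrite [X in _ = _ + X]big_ord_recr /= subnn addrA -big_split; congr (_ + _).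
by apply: eq_bigr => s _ /=; rewrite subSn -1?ltnS // big_ord_recr.
Qed.

(* Removals of copies of distinct parts commute, so only the terms where both
   operators act on the same part contribute. *)
Lemma kernel_op_comm k k' K K' f la : K (0, 0)%N = 0 -> K' (0, 0)%N = 0 ->
  kernel_op k K (kernel_op k' K' f) la =
  kernel_op k' K' (kernel_op k K f) la
  + kernel_op (k + k') (comm_kernel K K') f la.
Proof.
move=> K0 K'0; pose N := sumn (val la).
pose T (L L' : nat * nat -> rat) m m' :=
  \sum_(s < (mult m la).+1) \sum_(u < (mult m' (remove_parts la (nseq s m))).+1)
    L (mult m la, val s) * L' (mult m' (remove_parts la (nseq s m)), val u)
    * f (remove_parts (remove_parts la (nseq s m)) (nseq u m')).
have expand j j' L L' : L' (0, 0)%N = 0 ->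
    kernel_op j L (kernel_op j' L' f) la =
    \sum_(1 <= m < N.+1) \sum_(1 <= m' < N.+1)
      m%:R ^+ j * m'%:R ^+ j' * T L L' m m'.
  move=> L'0; apply: eq_bigr => m _.
  under eq_bigr => s _ do
    rewrite (kernel_op_widen _ _ L'0 (sumn_remove_parts la (nseq s m))) mulr_sumr.
  rewrite exchange_big /= mulr_sumr; apply: eq_bigr => m' _.
  rewrite -mulrA; congr (_ * _); rewrite mulr_sumr; apply: eq_bigr => s _.
  by rewrite mulrCA; congr (_ * _); rewrite mulr_sumr; apply: eq_bigr => u _; rewrite mulrA.
have T_off m m' : m != m' -> T K K' m m' = T K' K m' m.
  move=> ne_mm'.
  have multE i j s : i != j -> mult j (remove_parts la (nseq s i)) = mult j la.
    by move=> ne_ij; rewrite mult_remove_parts count_nseq /= (negPf ne_ij) mul0n subn0.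
  rewrite /T.
  under eq_bigr => s _ do rewrite multE //.
  under [RHS]eq_bigr => s _ do rewrite multE 1?eq_sym //.
  rewrite exchange_big; apply: eq_bigr => u _; apply: eq_bigr => s _ /=.
  by rewrite remove_partsC [K _ * _]mulrC.
have T_diag m : T K K' m m = T K' K m m
    + \sum_(t < (mult m la).+1) comm_kernel K K' (mult m la, val t)
        * f (remove_parts la (nseq t m)).
  pose r := mult m la.
  (* Removing s and then u copies of m is removing t = s + u copies, so the terms are grouped by
     t. *)
  have TE L L' : T L L' m m = \sum_(t < r.+1) \sum_(s < t.+1)
      L (r, val s) * L' (r - s, t - s)%N * f (remove_parts la (nseq t m)).
    rewrite /T -/r.
    under eq_bigr => s _ do rewrite mult_remove_parts count_nseq /= eqxx mul1n -/r.
    pose G s u := L (r, s) * L' (r - s, u)%N * f (remove_parts la (nseq (s + u) m)).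
    transitivity (\sum_(s < r.+1) \sum_(u < (r - s).+1) G s u).
      apply: eq_bigr => s _; apply: eq_bigr => u _; congr (_ * f _).
      by apply: part_eq => i; rewrite !mult_remove_parts !count_nseq mulnDr subnDA.
    rewrite triangle_sum_reindex; apply: eq_bigr => t _; apply: eq_bigr => s _.
    by rewrite /G subnKC // -ltnS.
  rewrite !TE -big_split; apply: eq_bigr => t _ /=.
  (* Reversing s to t - s in the product that starts with [K'] gives the second term of
     [comm_kernel]. *)
  rewrite /comm_kernel mulr_suml [X in _ = X + _](reindex_inj rev_ord_inj) -big_split.
  apply: eq_bigr => s _ /=; rewrite subSS subKn -1?ltnS //; ring.
rewrite !expand // [X in _ = X + _]exchange_big -big_split /=.
apply: eq_big_nat => m m_range.
have m_in : m \in index_iota 1 N.+1 by rewrite mem_index_iota.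
rewrite (bigD1_seq m) ?iota_uniq //= [in RHS](bigD1_seq m) ?iota_uniq //=.
rewrite T_diag addrAC mulrDr exprD; congr (_ + _ + _).
  by rewrite [m%:R ^+ k * _]mulrC.
by apply: eq_bigr => m' ne_m'; rewrite T_off 1?eq_sym // [m%:R ^+ k * _]mulrC.
Qed.

(** * Pointwise and induced products of power moments *)

(** This is [Tkl k l] without its additive constant. *)
Definition power_moment (k l : nat) (la : ipartition) : rat :=
  \sum_(1 <= m < (sumn (val la)).+1) m%:R ^+ k * faulhaber l (mult m la).

Lemma mul_kernel0 l : mul_kernel l (0, 0)%N = 0.
Proof. by rewrite /mul_kernel /faulhaber big_geq // mulr0. Qed.

Lemma add_kernel0 l : add_kernel l (0, 0)%N = 0.
Proof. by rewrite /add_kernel mul0r. Qed.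

Lemma kernel_op_mul k l f la :
  kernel_op k (mul_kernel l) f la = power_moment k l la * f la.
Proof.
rewrite mulr_suml; apply: eq_bigr => m _; rewrite -mulrA; congr (_ * _).
rewrite big_ord_recl big1 => [|s _]; last by rewrite /mul_kernel /= !mul0r.
by rewrite /mul_kernel /= remove_parts0 mul1r addr0.
Qed.

Lemma add_kernel_row_sum l r :
  \sum_(s < r.+1) add_kernel l (r, val s) = faulhaber l r.
Proof.
rewrite big_ord_recl /add_kernel /= mul0r add0r /faulhaber big_add1 /= big_mkord.
by apply: eq_bigr => s _; rewrite mul1r.
Qed.

Lemma kernel_op_const k K c la :
  kernel_op k K (fun=> c) la = \sum_(1 <= m < (sumn (val la)).+1)
     m%:R ^+ k * (c * \sum_(s < (mult m la).+1) K (mult m la, val s)).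
Proof.
apply: eq_bigr => m _; congr (_ * _); rewrite mulr_sumr.
by apply: eq_bigr => s _; rewrite mulrC.
Qed.

Lemma kernel_op_add1 k l la :
  kernel_op k (add_kernel l) (fun=> 1) la = power_moment k l la.
Proof.
by rewrite kernel_op_const; apply: eq_bigr => m _; rewrite mul1r add_kernel_row_sum.
Qed.

Lemma kernel_span0 e K : kernel_span e K -> K (0, 0)%N = 0.
Proof.
elim=> {K} [_ [a [b [b_gt0 _ ->]]]|f g _ f0 _ g0|c f _ f0||f g efg _ f0] //=.
- by rewrite expr0n -[b == 0%N]negbK -lt0n b_gt0 mulr0.
- by rewrite f0 g0 addr0.
- by rewrite f0 mulr0.
- by rewrite -efg.
Qed.

(* [words n] is the filtration by the number of factors in induced products of
   generators: [kernel_op k (add_kernel l)] is the induced product with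
   [power_moment k l]. *)
Inductive words : nat -> (ipartition -> rat) -> Prop :=
  | words_const n c : words n (fun _ => c)
  | words_add n k l f : (0 < l)%N -> ~~ odd (k + l) -> words n f ->
      words n.+1 (kernel_op k (add_kernel l) f)
  | wordsD n f g : words n f -> words n g -> words n (fun la => f la + g la)
  | wordsZ n c f : words n f -> words n (fun la => c * f la)
  | words_ext n f g : f =1 g -> words n f -> words n g.

Lemma wordsS n f : words n f -> words n.+1 f.
Proof.
elim=> {n f} [n c|n k l f l_gt0 kl _|n f g _ + _|n c f _|n f g efg _].
- exact: words_const.
- exact: words_add.
- exact: wordsD.
- exact: wordsZ.
- exact: words_ext.
Qed.

Lemma faulhaber_span_words n k p : faulhaber_span (~~ odd k) p ->
  words n.+1 (fun la => \sum_(1 <= m < (sumn (val la)).+1)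
                          m%:R ^+ k * p (mult m la)).
Proof.
elim=> {p} [_ [c [c_gt0 ec ->]]|f g _ IHf _ IHg|c f _ IHf||f g efg _].
- apply: words_ext (words_add (k := k) (l := c.+1) isT _ (words_const n 1)).
    by move=> la; rewrite kernel_op_add1.
  by rewrite oddD /= ec; case: (odd k).
- apply: words_ext (wordsD IHf IHg) => la; rewrite -big_split.
  by apply: eq_bigr => m _; rewrite mulrDr.
- apply: words_ext (wordsZ c IHf) => la; rewrite mulr_sumr.
  by apply: eq_bigr => m _; rewrite mulrCA.
- apply: words_ext (words_const _ 0) => la.
  by rewrite big1 // => m _; rewrite mulr0.
- by apply: words_ext => la; apply: eq_bigr => m _; rewrite efg.
Qed.

(** The operator is moved past the outermost addition operator. The commutator again has a kernel of
    the right parity and acts on a word with one factor fewer, so induction covers both terms; on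
    constants [kernel_row_sum] takes over. *)
Lemma kernel_op_words n f k K :
  words n f -> kernel_span (~~ odd k) K -> words n.+1 (kernel_op k K f).
Proof.
move=> wf; elim: wf k K => {n f}
  [n c|n k' l f l_gt0 kl wf IHf|n f g _ IHf _ IHg|n c f _ IHf|n f g efg _ IHf] k K span_K.
- have := faulhaber_span_words n (kernel_row_sum span_K).
  move/(wordsZ c); apply: words_ext => la.
  by rewrite kernel_op_const mulr_sumr; apply: eq_bigr => m _; rewrite mulrCA.
- have w1 := words_add l_gt0 kl (IHf k K span_K).
  have w2 : words n.+2 (kernel_op (k + k') (comm_kernel K (add_kernel l)) f).
    apply/wordsS/IHf; rewrite (_ : ~~ odd (k + k') = odd l (+) ~~ odd k).
      exact: comm_kernel_span.
    by move: kl; rewrite !oddD; case: (odd k) (odd k') (odd l) => [] [] [].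
  apply: words_ext (wordsD w1 w2) => la.
  by rewrite (kernel_op_comm _ _ _ _ (kernel_span0 span_K) (add_kernel0 l)).
- by apply: words_ext (wordsD (IHf _ _ span_K) (IHg _ _ span_K)) => la; rewrite kernel_opD.
- by apply: words_ext (wordsZ c (IHf _ _ span_K)) => la; rewrite kernel_opZ.
- by apply: words_ext (IHf _ _ span_K) => la; apply: kernel_op_ext.
Qed.

(** Neither kernel depends on the multiplicity, so the order of removals is irrelevant. *)
Lemma comm_add_kernel l l' x : (0 < l)%N -> (0 < l')%N ->
  comm_kernel (add_kernel l) (add_kernel l') x = 0.
Proof.
move=> l_gt0 l'_gt0; rewrite /comm_kernel sumrB /add_kernel /=.
by apply/eqP; rewrite subr_eq0; apply/eqP; apply: eq_bigr => s _; rewrite mulrC.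
Qed.

(** That the level n does not rise is what makes the induction in [words_inT] work. The difference
    operator kills constants, and its commutator with an addition operator is that of pointwise
    multiplication alone, since addition operators commute; [comm_mul_add_kernel] controls its
    kernel. *)
Lemma mul_sub_add_words n f k l : (0 < l)%N -> ~~ odd (k + l) -> words n f ->
  words n (fun la => power_moment k l la * f la - kernel_op k (add_kernel l) f la).
Proof.
move=> l_gt0 kl; elim=> {n f}
  [n c|n k' l' f l'_gt0 kl' wf IHf|n f g _ IHf _ IHg|n c f _ IHf|n f g efg _ IHf].
- apply: words_ext (words_const n 0) => la.
  rewrite (@kernel_op_ext _ _ _ (fun=> c * 1)) => [|mu]; last by rewrite mulr1.
  by rewrite kernel_opZ kernel_op_add1 mulrC subrr.
- have w1 := words_add l'_gt0 kl' IHf.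
  have w2 : words n.+1 (kernel_op (k + k') (comm_kernel (mul_kernel l) (add_kernel l')) f).
    apply: kernel_op_words wf _.
    rewrite (_ : ~~ odd (k + k') = ~~ odd (l + l')); first exact: comm_mul_add_kernel.
    by move: kl kl'; rewrite !oddD; case: (odd k) (odd k') (odd l) (odd l') => [] [] [] [].
  apply: words_ext (wordsD w1 w2) => la.
  rewrite -kernel_op_mul kernel_op_comm ?mul_kernel0 ?add_kernel0 //.
  rewrite [X in _ = _ - X]kernel_op_comm ?add_kernel0 //.
  rewrite (@kernel_op_ext_kernel _ (comm_kernel (add_kernel l) (add_kernel l'))
    (fun=> 0)); last by move=> x _; apply: comm_add_kernel.
  rewrite [X in _ - (_ + X)]big1 ?addr0; last first.
    by move=> m _; rewrite big1 ?mulr0 // => s _; rewrite mul0r.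
  rewrite (kernel_op_ext _ _ _ (g := fun mu => kernel_op k (mul_kernel l) f mu
     + (-1) * kernel_op k (add_kernel l) f mu)).
    by rewrite kernel_opD kernel_opZ mulN1r addrAC.
  by move=> mu; rewrite kernel_op_mul mulN1r.
- apply: words_ext (wordsD IHf IHg) => la; rewrite kernel_opD; ring.
- apply: words_ext (wordsZ c IHf) => la; rewrite kernel_opZ; ring.
- by apply: words_ext IHf => la; rewrite efg (kernel_op_ext _ _ _ efg).
Qed.

Lemma power_moment_mul_words n f k l : (0 < l)%N -> ~~ odd (k + l) -> words n f ->
  words n.+1 (fun la => power_moment k l la * f la).
Proof.
move=> l_gt0 kl wf.
apply: words_ext (wordsD (words_add l_gt0 kl wf)
                    (wordsS (mul_sub_add_words l_gt0 kl wf))) => la.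
by rewrite addrC subrK.
Qed.

Lemma words_le n n' f : (n <= n')%N -> words n f -> words n' f.
Proof. by move=> /subnK <- wf; elim: (n' - n)%N => //= d; apply: wordsS. Qed.

(** With an arbitrary word [g] in the statement, a product in [inT] is handled by composing two
    multiplications, so two words never have to be multiplied directly. *)
Lemma inT_mul_words f : inT f ->
  forall n g, words n g -> exists n', words n' (fun la => f la * g la).
Proof.
elim=> {f} [k l l_gt0 kl|c|f1 f2 _ IH1 _ IH2|f1 f2 _ IH1 _ IH2] n g wg.
- pose c := - bernoulli (k + l) / (2 * (k + l)%:R) * ((l == 1)%:R + (k == 0)%:R).
  exists n.+1.
  apply: words_ext (wordsD (wordsS (wordsZ c wg)) (power_moment_mul_words l_gt0 kl wg)) => la.
  by rewrite -mulrDl.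
- by exists n; apply: wordsZ.
- have [n1 w1] := IH1 n g wg; have [n2 w2] := IH2 n g wg.
  exists (maxn n1 n2).
  apply: words_ext (wordsD (words_le (leq_maxl n1 n2) w1) (words_le (leq_maxr n1 n2) w2)) => la.
  by rewrite mulrDl.
- have [n2 w2] := IH2 n g wg; have [n1 w1] := IH1 n2 _ w2.
  by exists n1; apply: words_ext w1 => la; rewrite mulrA.
Qed.

Lemma inT_words f : inT f -> exists n, words n f.
Proof.
move=> Tf; have [n wf] := inT_mul_words Tf (words_const 0 1).
by exists n; apply: words_ext wf => la; rewrite mulr1.
Qed.

(** [inT] has no extensionality rule, so membership is stated up to [=1]. *)
Lemma power_moment_inT k l : (0 < l)%N -> ~~ odd (k + l) ->
  exists2 g, inT g & power_moment k l =1 g.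
Proof.
move=> l_gt0 kl.
pose c := - bernoulli (k + l) / (2 * (k + l)%:R) * ((l == 1)%:R + (k == 0)%:R).
exists (fun la => - c + Tkl k l la); first by apply: inT_add (inT_const _) (inT_gen _ _).
by move=> la; rewrite /Tkl addKr.
Qed.

(** Strong induction on the level, with an inner induction on the word. An induced factor S applied
    to f equals the pointwise product S f minus the difference of [mul_sub_add_words], and both f
    and this difference have lower level. *)
Lemma words_inT n f : words n f -> exists2 g, inT g & f =1 g.
Proof.
elim/ltn_ind: n f => n IHn f wf; elim: wf IHn => {n f}
  [n c|n k l f l_gt0 kl wf _|n f g _ IHf _ IHg|n c f _ IHf|n f g efg _ IHf] IHn.
- by exists (fun=> c); first exact: inT_const.
- have [f' Tf' ff'] := IHn n (ltnSn n) f wf.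
  have [S TS SE] := power_moment_inT l_gt0 kl.
  have [d Td dE] := IHn n (ltnSn n) _ (mul_sub_add_words l_gt0 kl wf).
  exists (fun la => S la * f' la + (-1) * d la).
    by apply: inT_add; apply: inT_mul => //; apply: inT_const.
  by move=> la; rewrite mulN1r -SE -ff' -dE opprB addrC subrK.
- have [f' Tf' ff'] := IHf IHn; have [g' Tg' gg'] := IHg IHn.
  exists (fun la => f' la + g' la); first exact: inT_add.
  by move=> la; rewrite ff' gg'.
- have [f' Tf' ff'] := IHf IHn.
  exists (fun la => c * f' la); first exact: inT_mul (inT_const c) Tf'.
  by move=> la; rewrite ff'.
- by have [f' Tf' ff'] := IHf IHn; exists f' => // la; rewrite -efg.
Qed.

(** * Multiplication of series *)

Lemma mem_bitseqs n m : (m \in bitseqs n) = (size m == n).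
Proof.
elim: n m => [|n IHn] [|b m] //=; rewrite cats0 mem_cat.
  by apply/negbTE; rewrite negb_or; apply/andP; split; apply/mapP => -[].
rewrite eqSS -IHn; apply/orP/idP => [[] /mapP[s s_in [_ ->]] //|m_in].
by case: b; [left | right]; apply: map_f.
Qed.

Lemma count_mask_split (T : Type) (a : pred T) m s : size m = size s ->
  (count a (mask m s) + count a (mask (map negb m) s))%N = count a s.
Proof.
elim: s m => [|x s IHs] [|b m] //= [/IHs <-].
by case: b => /=; rewrite -?addnA // addnCA.
Qed.

(** Masks are traded for multiplicities, which determine a partition; sortedness upgrades the
    permutation from [count_maskP] to an equality. *)
Lemma decompP la p :
  reflect [/\ is_part p.1, is_part p.2
            & forall m, (count_mem m p.1 + count_mem m p.2)%N = mult m la]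
          (p \in decomp (val la)).
Proof.
case: p => s t; rewrite mem_undup; apply: (iffP mapP) => /=.
  case=> m; rewrite mem_bitseqs => /eqP size_m [-> ->].
  split; try by apply: is_part_subseq (valP la); apply: mask_subseq.
  by move=> j; rewrite count_mask_split.
case=> s_part t_part st_la.
have /count_maskP[m size_m /permP s_mask] :
    forall x, (count_mem x s <= count_mem x (val la))%N.
  by move=> x; rewrite -[leqRHS]st_la leq_addr.
exists m; first by rewrite mem_bitseqs size_m.
have mask_part b : is_part (mask b (val la)).
  exact: is_part_subseq (mask_subseq _ _) (valP la).
congr (_, _); apply: part_eq_seq => // j.
by apply/eqP; rewrite -(eqn_add2l (count_mem j s)) st_la s_mask count_mask_split.
Qed.

Definition subpart (y la : ipartition) : bool :=
  all (fun m => mult m y <= mult m la)%N (val y).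

Lemma subpartP y la :
  reflect (forall m, (mult m y <= mult m la)%N) (subpart y la).
Proof.
apply: (iffP allP) => [le_y_la m|le_y_la m _]; last exact: le_y_la.
have [m_y|/count_memPn m_y] := boolP (m \in val y); first exact: le_y_la.
by rewrite /mult m_y.
Qed.

(** A factorization is determined by its second factor. Leaving [L] free allows products at several
    partitions to be summed over one list. *)
Lemma mulSE (A f : ipartition -> rat) la (L : seq ipartition) : uniq L ->
  (forall y, subpart y la -> y \in L) ->
  mulS A f la = \sum_(y <- L | subpart y la) A (remove_parts la (val y)) * f y.
Proof.
move=> uniqL subL; pose g (y : ipartition) := (val (remove_parts la (val y)), val y).
transitivity (\sum_(p <- [seq g y | y <- L & subpart y la])
                 A (topart p.1) * f (topart p.2)).
  apply/perm_big/uniq_perm; first exact: undup_uniq.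
    by rewrite map_inj_uniq ?filter_uniq // => x y [_ /val_inj].
  move=> p; apply/decompP/mapP => [[part1 part2 p_la]|[y]].
    have sub2 : subpart (topart p.2) la.
      by apply/subpartP => m; rewrite /mult topartK // -[leqRHS]p_la leq_addl.
    exists (topart p.2); first by rewrite mem_filter sub2 subL.
    rewrite /g topartK // [LHS]surjective_pairing; congr (_, _).
    apply: part_eq_seq => // [|m]; first exact: valP.
    by rewrite -/(mult _ _) mult_remove_parts -p_la addnK.
  rewrite mem_filter => /andP[/subpartP sub_y _] ->; split; [exact: valP
    | exact: valP | move=> m /=].
  exact: etrans (congr1 (addn^~ _) (mult_remove_parts _ _ _)) (subnK (sub_y m)).
by rewrite big_map big_filter; apply: eq_bigr => y _; congr (A _ * f _); apply: valKd.
Qed.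

Definition subparts (la : ipartition) : seq ipartition :=
  undup [seq topart p.2 | p <- decomp (val la)].

Lemma mem_subparts y la : subpart y la -> y \in subparts la.
Proof.
move/subpartP=> sub_y; rewrite mem_undup -[y](valKd part0).
apply: (map_f (fun p => topart p.2) (x := (val (remove_parts la (val y)), val y))).
apply/decompP; split; [exact: valP | exact: valP | move=> m /=].
exact: etrans (congr1 (addn^~ _) (mult_remove_parts _ _ _)) (subnK (sub_y m)).
Qed.

Lemma subpart_trans x y la : subpart x y -> subpart y la -> subpart x la.
Proof.
move=> /subpartP xy /subpartP yla; apply/subpartP => m.
exact: leq_trans (xy m) (yla m).
Qed.

Lemma remove_parts_sub la t : subpart (remove_parts la t) la.
Proof. by apply/subpartP => m; rewrite mult_remove_parts leq_subr. Qed.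

Lemma eq_mulS A A' f f' la : A =1 A' -> f =1 f' -> mulS A f la = mulS A' f' la.
Proof. by move=> eA ef; apply: eq_bigr => p _; rewrite eA ef. Qed.

Lemma mulSDl A A' f la :
  mulS (fun mu => A mu + A' mu) f la = mulS A f la + mulS A' f la.
Proof. by rewrite -big_split; apply: eq_bigr => p _ /=; rewrite mulrDl. Qed.

Lemma mulSZl c A f la : mulS (fun mu => c * A mu) f la = c * mulS A f la.
Proof. by rewrite mulr_sumr; apply: eq_bigr => p _; rewrite mulrA. Qed.

Lemma mulSC A f la : mulS A f la = mulS f A la.
Proof.
pose swap (p : seq nat * seq nat) := (p.2, p.1).
have swapK : involutive swap by case.
transitivity (\sum_(p <- map swap (decomp (val la))) A (topart p.1) * f (topart p.2)).
  apply/perm_big/uniq_perm; rewrite ?map_inj_uniq ?undup_uniq //.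
    exact: inv_inj.
  move=> p; rewrite -[p in RHS]swapK mem_map; last exact: inv_inj.
  by apply/decompP/decompP => -[? ? p_la]; split=> // m; rewrite addnC p_la.
by rewrite big_map; apply: eq_bigr => p _; rewrite mulrC.
Qed.

(** An addition operator is multiplication by a series, and this is the associativity it obeys. Both
    sides remove s copies of m and a subpartition y; the removals commute, and the weight of
    [add_kernel] ignores the multiplicity, which the first removal may change. *)
Lemma kernel_op_mulS k l A f la :
  kernel_op k (add_kernel l) (mulS A f) la = mulS (kernel_op k (add_kernel l) A) f la.
Proof.
rewrite [RHS](mulSE _ _ (undup_uniq _) (@mem_subparts ^~ la)).
pose w s : rat := add_kernel l (0, s)%N.
pose F m s (y : ipartition) :=
  m%:R ^+ k * (w s * A (remove_parts (remove_parts la (nseq s m)) (val y)) * f y).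
transitivity (\sum_(1 <= m < (sumn (val la)).+1) \sum_(s < (mult m la).+1)
    \sum_(y <- subparts la | subpart y (remove_parts la (nseq s m))) F m s y).
  apply: eq_bigr => m _; rewrite mulr_sumr; apply: eq_bigr => s _.
  rewrite (@mulSE _ _ _ (subparts la)) ?undup_uniq //.
    by rewrite !mulr_sumr; apply: eq_bigr => y _; rewrite /F -mulrA.
  by move=> y sub_y; apply/mem_subparts/(subpart_trans sub_y)/remove_parts_sub.
transitivity (\sum_(y <- subparts la | subpart y la) \sum_(1 <= m < (sumn (val la)).+1)
    \sum_(s < (mult m (remove_parts la (val y))).+1) F m s y); last first.
  apply: eq_bigr => y _.
  rewrite (kernel_op_widen _ _ (add_kernel0 l) (sumn_remove_parts la (val y))).
  rewrite mulr_suml; apply: eq_bigr => m _; rewrite -mulrA; rewrite mulr_suml mulr_sumr.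
  apply: eq_bigr => s _; rewrite /F; congr (_ * (_ * A _ * _)).
  exact: remove_partsC.
rewrite [RHS]exchange_big; apply: eq_bigr => m _ /=.
have widen y : \sum_(s < (mult m (remove_parts la (val y))).+1) F m s y
  = \sum_(s < (mult m la).+1 | (s <= mult m la - mult m y)%N) F m s y.
  rewrite mult_remove_parts -/(mult _ _).
  rewrite (big_ord_widen (mult m la).+1 (fun s => F m s y)) ?ltnS ?leq_subr //.
under [RHS]eq_bigr do rewrite widen.
rewrite (exchange_big_dep (fun y => subpart y la)) /= => [|s y _]; last first.
  by move/subpart_trans; apply; apply: remove_parts_sub.
(* For y inside [la], both conditions say that y together with s copies of m still fits in [la]. *)
apply: eq_bigr => y sub_y; apply: eq_bigl => s; have := subpartP _ _ sub_y.
move=> sub_y'; apply/subpartP/idP => [/(_ m)|le_s j].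
  by have := ltn_ord s; rewrite mult_remove_parts count_nseq /= eqxx mul1n; lia.
rewrite mult_remove_parts count_nseq /=; case: eqP => [<-|_].
  by have := sub_y' m; lia.
by rewrite mul0n subn0.
Qed.

(** * Inverse series and the unit *)

Lemma decomp_size_lt (la : ipartition) p :
  p \in decomp (val la) -> p.1 != val la -> (size p.1 < size (val la))%N.
Proof.
move=> /decompP[part1 part2 p_la] ne_p.
have /perm_size <- : perm_eq (p.1 ++ p.2) (val la).
  by apply/allP => m _; rewrite /= count_cat p_la.
rewrite size_cat -[ltnLHS]addn0 ltn_add2l lt0n size_eq0.
apply: contra ne_p => /eqP p2_nil; apply/eqP/part_eq_seq => // [|m].
  exact: valP.
by rewrite -/(mult _ _) -p_la p2_nil addn0.
Qed.

(** Any fuel of at least the number of parts suffices, since each recursive call passes to a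
    partition with fewer parts. *)
Lemma inv_rec_stable n A la : (size (val la) <= n)%N -> inv_rec n A la = invS A la.
Proof.
have inv_nil m mu : val mu = [::] -> inv_rec m A mu = (A part0)^-1.
  by case: m => [|m] /= ->.
have [N le_N] : exists N, (size (val la) <= N)%N by exists (size (val la)).
elim: N la le_N n => [|N IHN] la le_N n le_n; rewrite /invS.
  by move: le_N; rewrite leqn0 => /nilP la0; rewrite !inv_nil.
have [la0|la_n0] := eqVneq (val la) [::]; first by rewrite !inv_nil.
case: n le_n => [|n] le_n.
  by move: le_n la_n0; rewrite leqn0 => /nilP ->.
case size_la: (size (val la)) => [|n'].
  by move: size_la la_n0 => /size0nil ->.
rewrite /= (negPf la_n0); congr (_ * _); rewrite big_seq_cond [RHS]big_seq_cond.
apply: eq_bigr => p /andP[p_in ne_p]; congr (_ * _).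
have lt_p := decomp_size_lt p_in ne_p.
have part1 : is_part p.1 by case/decompP: p_in.
rewrite -[p.1]topartK // in lt_p.
by rewrite !IHN // -ltnS ?(leq_trans lt_p) // -size_la.
Qed.

Lemma topart_val la : topart (val la) = la.
Proof. exact: valKd. Qed.

Lemma topart_nil : topart [::] = part0.
Proof. exact: (topart_val part0). Qed.

Definition deltaS (la : ipartition) : rat := (val la == [::])%:R.

(** For nonempty [la], the factorization with trivial second factor contributes
    [invS A la * A part0]; the recursion defines [invS] so that this cancels all the others. *)
Lemma mul_invS A la : A part0 != 0 -> mulS (invS A) A la = deltaS la.
Proof.
move=> A0; rewrite /deltaS; have [la0|la_n0] := eqVneq (val la) [::].
  rewrite (_ : la = part0); last exact: val_inj.
  by rewrite /mulS /= big_seq1 topart_nil mulVf.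
have in_la : (val la, [::]) \in decomp (val la).
  by apply/decompP; split=> [||m]; rewrite ?addn0 //; apply: valP.
rewrite /mulS (bigD1_seq _ in_la) ?undup_uniq //= topart_val topart_nil.
case size_la: (size (val la)) => [|n]; first by move: size_la la_n0 => /size0nil ->.
rewrite {1}/invS size_la /= (negPf la_n0) mulrAC mulNr mulVf // mulN1r.
apply/eqP; rewrite addrC subr_eq0; apply/eqP.
(* The recursion excludes by first factor, [bigD1_seq] by the whole pair; within [decomp] these
   agree because a full first factor leaves nothing. *)
have eq_cond p : p \in decomp (val la) ->
    (p != (val la, [::])) = (p.1 != val la).
  case/decompP=> part1 part2 p_la.
  apply/idP/idP; apply: contra => /eqP p_eq; last by rewrite p_eq.
  rewrite [p in p == _]surjective_pairing xpair_eqE p_eq eqxx /=; apply/eqP.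
  apply: part_eq_seq => // m; apply/eqP.
  by rewrite -(eqn_add2l (count_mem m p.1)) p_la p_eq addn0.
rewrite big_seq_cond [RHS]big_seq_cond; apply: eq_big => p.
  exact: andb_id2l (eq_cond p).
case/andP=> p_in; rewrite eq_cond // => ne_p.
rewrite inv_rec_stable // topartK.
  by rewrite -ltnS -size_la decomp_size_lt.
by case/decompP: p_in.
Qed.

Lemma mul_deltaS A la : mulS deltaS A la = A la.
Proof.
have sub_la : subpart la la by apply/subpartP.
rewrite (mulSE _ _ (undup_uniq _) (@mem_subparts ^~ la)).
rewrite big_mkcond (bigD1_seq la) ?undup_uniq ?mem_subparts //= sub_la.
rewrite big1_seq => [|y].
  rewrite addr0 (_ : remove_parts la (val la) = part0) ?mul1r //.
  by apply: part_eq => m; rewrite mult_remove_parts subnn.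
case/andP=> ne_y _; case: subpartP => // sub_y.
rewrite /deltaS; case: eqP => [rem0|_]; last by rewrite mul0r.
case/eqP: ne_y; apply: part_eq => m; apply/eqP.
rewrite eqn_leq sub_y /= -subn_eq0 -[(_ - _)%N](mult_remove_parts m la (val y)).
by rewrite /mult rem0.
Qed.

(** * The induced product of words *)

Lemma qbracketE f la : qbracket f la = mulS f (invS (fun _ => 1)) la.
Proof. by []. Qed.

Lemma qbracket_const c la : qbracket (fun _ => c) la = c * deltaS la.
Proof.
rewrite qbracketE -(@mul_invS (fun _ => 1)) // -[in RHS]mulSC -mulSZl.
by apply: eq_mulS => // mu; rewrite mulr1.
Qed.

(** The witness is the word [f] with each constant c replaced by c times [g]. Brackets of constants
    are multiples of the unit series, and [kernel_op_mulS] carries addition operators through the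
    bracket and through the product. *)
Lemma words_induced_mul n f g : words n f -> inT g ->
  exists n' h, words n' h /\ qbracket h =1 mulS (qbracket f) (qbracket g).
Proof.
move=> wf Tg; have [n0 wg] := inT_words Tg.
elim: wf => {n f}
  [n c|n k l f l_gt0 kl _ [n' [h [wh hE]]]
  |n f1 f2 _ [n1 [h1 [wh1 h1E]]] _ [n2 [h2 [wh2 h2E]]]
  |n c f _ [n' [h [wh hE]]]|n f f' ff' _ [n' [h [wh hE]]]].
- exists n0, (fun la => c * g la); split=> [|la]; first exact: wordsZ.
  rewrite (eq_mulS _ (qbracket_const c) (frefl _)) mulSZl mul_deltaS.
  exact: mulSZl.
- exists n'.+1, (kernel_op k (add_kernel l) h); split=> [|la]; first exact: words_add.
  rewrite qbracketE -kernel_op_mulS (kernel_op_ext _ _ _ hE) kernel_op_mulS.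
  by apply: eq_mulS => // mu; rewrite kernel_op_mulS.
- exists (maxn n1 n2), (fun la => h1 la + h2 la); split=> [|la].
    exact: wordsD (words_le (leq_maxl n1 n2) wh1) (words_le (leq_maxr n1 n2) wh2).
  rewrite qbracketE mulSDl -!qbracketE h1E h2E -mulSDl.
  by apply: eq_mulS => // mu; rewrite [RHS]mulSDl.
- exists n', (fun la => c * h la); split=> [|la]; first exact: wordsZ.
  rewrite qbracketE mulSZl -qbracketE hE -mulSZl.
  by apply: eq_mulS => // mu; rewrite [RHS]mulSZl.
- exists n', h; split=> // la; rewrite hE.
  by apply: eq_mulS => // mu; apply: eq_mulS.
Qed.

Theorem theorem4p2p1 (f g : ipartition -> rat) :
  inT f -> inT g ->
  exists h : ipartition -> rat,
    inT h /\ (forall la : ipartition, qbracket h la = mulS (qbracket f) (qbracket g) la).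
Proof.
move=> Tf Tg; have [n wf] := inT_words Tf.
have [n' [h [wh hE]]] := words_induced_mul wf Tg.
have [h' Th' hh'] := words_inT wh.
exists h'; split=> // la; rewrite -hE.
by apply: eq_mulS => // mu; rewrite -hh'.
Qed.
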